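(* Let $u$ and $v$ be nonadjacent (distinct) vertices of a graph $G$. Then $\gamma(G)-1 \leq \gamma(G_{u,v,1}) \leq \gamma(G)+1$. Moreover: (i) $\gamma(G)-1 = \gamma(G_{u,v,1})$ if and only if $\gamma(G-\{u,v\}) = \gamma(G)-2$. (ii) $\gamma(G_{u,v,1}) = \gamma(G)+1$ if and only if both $u$ and $v$ are $\gamma$-bad vertices of $G$, $u \notin V^-(G-v)$ and $v \notin V^-(G-u)$. If $\gamma(G_{u,v,1}) = \gamma(G)+1$, then $x_1 \in V^-(G_{u,v,1})$.
   Context: Graphs are finite and simple. $\gamma(H)$ denotes the domination number of a graph $H$, with $\gamma=0$ for the graph with no vertices; a $\gamma$-set of $H$ is a dominating set of $H$ of cardinality $\gamma(H)$. A vertex of $H$ is $\gamma$-bad if it belongs to no $\gamma$-set of $H$. $V^-(H) = \{x \in V(H) \mid \gamma(H-x) < \gamma(H)\}$. For distinct vertices $u,v$ of $G$, $G_{u,v,1}$ is the graph obtained from $G$ by adding one new vertex $x_1$ and the edges $ux_1$ and $x_1v$. *)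

(* Defs.v *)
From HB Require Import structures.
From mathcomp Require Import all_boot all_order all_algebra.

Set Implicit Arguments.
Unset Strict Implicit.
Unset Printing Implicit Defensive.

Record sgraph := SGraph {
  vertex :> finType;
  adj : rel vertex;
  adj_sym : symmetric adj;
  adj_irr : irreflexive adj }.

Section Induced.
Variables (G : sgraph) (A : {set G}).

Definition induced_adj : rel {x : G | x \in A} := fun x y => adj (val x) (val y).

Lemma induced_sym : symmetric induced_adj.
Proof. by move=> x y; exact: adj_sym. Qed.

Lemma induced_irr : irreflexive induced_adj.
Proof. by move=> x; exact: adj_irr. Qed.

Definition induced : sgraph := SGraph induced_sym induced_irr.

End Induced.

Definition del_set (G : sgraph) (A : {set G}) : sgraph := induced (~: A).
Definition del_vertex (G : sgraph) (x : G) : sgraph := del_set [set x].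

Section Domination.
Variable G : sgraph.

Definition dominating (D : {set G}) : bool :=
  [forall x, (x \in D) || [exists y in D, adj y x]].

(* The seed [set: G] of the minimization is itself dominating, so this is a
   minimum over a nonempty family. *)
Definition gamma : nat := #|[arg min_(D < [set: G] | dominating D) #|D|]|.

Definition gamma_set (D : {set G}) : bool := dominating D && (#|D| == gamma).

Definition gamma_bad (x : G) : bool := [forall D, gamma_set D ==> (x \notin D)].

End Domination.

Definition Vminus (G : sgraph) : {set G} :=
  [set x | gamma (del_vertex x) < gamma G].

(* G_{u,v,1}: the vertices of G are embedded by Some, and the added vertex x_1
   is None. *)
Section AddPath.
Variables (G : sgraph) (u v : G).

Definition add_path1_adj : rel (option G) := fun a b =>
  match a, b with
  | Some x, Some y => adj x y
  | Some x, None | None, Some x => (x == u) || (x == v)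
  | None, None => false
  end.

Lemma add_path1_sym : symmetric add_path1_adj.
Proof. by case=> [x|] [y|] //=; exact: adj_sym. Qed.

Lemma add_path1_irr : irreflexive add_path1_adj.
Proof. by case=> [x|] //=; exact: adj_irr. Qed.

Definition add_path1 : sgraph := SGraph add_path1_sym add_path1_irr.

Definition new_vertex : add_path1 := None.

End AddPath.

(* Main.v *)
Require Import Defs.
From HB Require Import structures.
From mathcomp Require Import all_boot all_order all_algebra.
From mathcomp Require Import zify.

(* Removing [x_1] from a dominating set [D] of [G_{u,v,1}] leaves either a set
   of size [#|D| - 1] dominating at least the vertices of [G - {u, v}], or a
   dominating set of [G] of size [#|D|] meeting [{u, v}].  Both kinds of set
   extend back, so [gamma (G_{u,v,1})] is determined by the minimal sizes of
   these sets, and all the claims follow by adding [u] and [v] to such sets.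
   For (ii), badness of [v] gives [gamma (G - v) = gamma G]; hence
   [u \notin V^-(G - v)] just says [gamma G <= gamma (G - {u, v})], a condition
   symmetric in [u] and [v]. *)

Set Implicit Arguments.
Unset Strict Implicit.
Unset Printing Implicit Defensive.

(** * Domination of a set of vertices, and thresholds for the domination number *)

Section Dominates.
Variable G : sgraph.
Implicit Types (D W : {set G}) (x : G) (k : nat).

(* [D] need not be contained in [W]. *)
Definition dominates D W :=
  [forall x in W, (x \in D) || [exists y in D, adj y x]].

Lemma dominatesP D W :
  reflect {in W, forall x, x \in D \/ exists2 y, y \in D & adj y x}
          (dominates D W).
Proof.
apply: (iffP forall_inP) => h x /h.
  by case/orP=> [|/exists_inP]; [left | right].
by case=> [->//|/exists_inP ->]; rewrite orbT.
Qed.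

Lemma dominating_setT D : dominating D = dominates D setT.
Proof. by apply: eq_forallb => x; rewrite inE. Qed.

Lemma dominates_sub D D' W W' :
  D \subset D' -> W' \subset W -> dominates D W -> dominates D' W'.
Proof.
move=> /subsetP sD /subsetP sW /dominatesP h; apply/dominatesP => x /sW /h.
by case=> [/sD|[y /sD yD yx]]; [left | right; exists y].
Qed.

Lemma dominates_setU1 D W x : dominates D (W :\ x) -> dominates (x |: D) W.
Proof.
move=> /dominatesP h; apply/dominatesP => y yW; rewrite !inE.
have [_|yx] := eqVneq y x; first by left.
case: (h y) => [|-> //|[z zD zy]]; rewrite ?inE ?yx //; first by left.
by right; exists z; rewrite ?inE ?zD ?orbT.
Qed.

(** Stating every threshold [k] replaces the arg min by explicit sets; [k := gamma G] yields a
    minimum dominating set. *)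
Lemma gamma_leP k :
  reflect (exists2 D, dominates D setT & #|D| <= k) (gamma G <= k).
Proof.
rewrite /gamma; case: arg_minnP => [|D].
  by apply/forallP => x; rewrite inE.
rewrite dominating_setT => domD minD.
apply: (iffP idP) => [|[D' domD']]; first by exists D.
by apply: leq_trans; apply: minD; rewrite dominating_setT.
Qed.

Lemma gamma_le_card D : dominates D setT -> gamma G <= #|D|.
Proof. by move=> domD; apply/gamma_leP; exists D. Qed.

Lemma gamma_badP x :
  reflect (forall D, dominates D setT -> x \in D -> gamma G < #|D|)
          (gamma_bad x).
Proof.
apply: (iffP forallP) => [h D domD xD | h D].
  move: (h D); rewrite /gamma_set dominating_setT domD xD implybF /=.
  by rewrite ltn_neqAle eq_sym => ->; exact: gamma_le_card.
apply/implyP => /andP[]; rewrite dominating_setT => domD /eqP cD.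
by apply/negP => /(h _ domD); rewrite cD ltnn.
Qed.

End Dominates.

(** * Domination numbers of induced subgraphs, computed in the ambient graph *)

Section Embedding.
Variables (G H : sgraph) (f : G -> H).
Hypotheses (f_inj : injective f) (f_adj : {mono f : x y / adj x y}).

Lemma dominates_imset (D W : {set G}) :
  dominates (f @: D) (f @: W) = dominates D W.
Proof.
apply/dominatesP/dominatesP => [h x xW | h _ /imsetP[x xW ->]].
  case: (h (f x)); rewrite ?mem_imset //; first by left.
  by case=> _ /imsetP[y yD ->]; rewrite f_adj; right; exists y.
case: (h x xW) => [xD|[y yD yx]]; first by left; apply: imset_f.
by right; exists (f y); rewrite ?f_adj // imset_f.
Qed.

(** A set inside the image of [f] is the image of its preimage, so dominating sets of [G] correspond
    to such sets with the same cardinality. *)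
Lemma gamma_le_embedP k :
  reflect (exists D : {set H},
             [/\ D \subset f @: setT, dominates D (f @: setT) & #|D| <= k])
          (gamma G <= k).
Proof.
apply: (iffP (gamma_leP _ _)) => [[D domD leD] | [D [/subsetP sD]]].
  by exists (f @: D); rewrite dominates_imset imsetS ?subsetT ?card_imset.
have <- : f @: (f @^-1: D) = D.
  apply/setP => y; apply/imsetP/idP => [[x] | yD]; first by rewrite inE => + ->.
  by have /imsetP[x _ yx] := sD _ yD; exists x; rewrite ?inE -?yx.
by rewrite dominates_imset card_imset // => domD leD; exists (f @^-1: D).
Qed.

End Embedding.

Lemma gamma_inducedP (G : sgraph) (A : {set G}) k :
  reflect (exists D : {set G}, [/\ D \subset A, dominates D A & #|D| <= k])
          (gamma (induced A) <= k).
Proof.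
have im : [set val x | x in [set: induced A]] = A.
  apply/setP => x; apply/imsetP/idP => [[y _ ->] | xA]; first exact: valP.
  by exists (Sub x xA).
have embP := gamma_le_embedP (f := val : induced A -> G) val_inj.
by rewrite im in embP; exact: embP.
Qed.

(** The two graphs live on different types but embed in [G] with the same image, so their domination
    numbers satisfy the same upper bounds. *)
Lemma gamma_del_vertex2 (G : sgraph) (v : G) (x : del_vertex v) :
  gamma (del_vertex x) = gamma (del_set [set val x; v]).
Proof.
suff le_iff k :
    (gamma (del_vertex x) <= k) = (gamma (del_set [set val x; v]) <= k).
  by apply/eqP; rewrite eqn_leq le_iff leqnn -le_iff leqnn.
have im : [set val (val y) | y in [set: del_vertex x]] = ~: [set val x; v].
  apply/setP => z; apply/imsetP/idP => [[y _ ->] | ].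
    move: (valP y) (valP (val y)); rewrite !inE negb_or => yx ->.
    by rewrite andbT; apply: contra yx => /eqP/val_inj/eqP.
  rewrite !inE negb_or => /andP[zx zv].
  have zA : z \in ~: [set v] by rewrite !inE.
  have zB : (Sub z zA : del_vertex v) \in ~: [set x].
    by rewrite !inE; apply: contra zx => /eqP <-.
  by exists (Sub (Sub z zA : del_vertex v) zB).
pose f (y : del_vertex x) : G := val (val y).
have f_inj : injective f by move=> y z /val_inj/val_inj.
have embP := gamma_le_embedP f_inj (fun _ _ => erefl) k.
by rewrite im in embP; apply/embP/gamma_inducedP.
Qed.

(** * Dominating sets of the graph with the added vertex *)

Section AddPathGamma.
Variables (G : sgraph) (u v : G).
Let H := add_path1 u v.

(** The alternatives are whether [x_1] is chosen. If so, it takes care of [u] and [v] at the cost of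
    one element, hence the strict bound; if not, [u] or [v] must be chosen to dominate it. *)
Lemma gamma_add_path1_leP k :
  reflect ((exists2 D, dominates D (~: [set u; v]) & #|D| < k) \/
           (exists D : {set G}, [/\ dominates D setT, (u \in D) || (v \in D)
                        & #|D| <= k]))
          (gamma H <= k).
Proof.
have Some_inj : injective (@Some G) by move=> ? ? [].
apply: (iffP (gamma_leP H k)) => [[E /dominatesP domE leE] | ].
  pose D := [set x | Some x \in E].
  have defD : E :\ None = Some @: D.
    apply/setP => -[x|]; rewrite !inE ?(mem_imset _ _ Some_inj) ?inE //=.
    by apply/esym/negP => /imsetP[].
  have cE : #|E| = (None \in E) + #|D|.
    by rewrite (cardsD1 None) defD card_imset.
  case: (boolP (None \in E)) cE => NE cE; [left | right]; exists D; try lia.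
    apply/dominatesP => x; rewrite !inE negb_or => /andP[xu xv].
    case: (domE (Some x)) => [||[[y|] yE yx]]; rewrite ?inE //.
    - by left.
    - by right; exists y; rewrite ?inE.
    - by move: yx; rewrite /= (negPf xu) (negPf xv).
  split; last lia.
    apply/dominatesP => x _.
    case: (domE (Some x)) => [||[[y|] yE yx]]; rewrite ?inE //.
    - by left.
    - by right; exists y; rewrite ?inE.
    - by rewrite yE in NE.
  case: (domE None) => [||[[y|] yE //= yuv]]; rewrite ?inE // ?(negPf NE) //.
  by case/orP: yuv => /eqP <-; rewrite yE ?orbT.
case=> [[D domD ltD] | [D [domD uvD leD]]].
  exists (None |: Some @: D).
    apply/dominatesP => -[x _|_]; last by left; rewrite !inE.
    case: (boolP (x \in [set u; v])) => [xuv | nxuv].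
      by right; exists None; rewrite !inE // in xuv *.
    move/dominatesP: domD => /(_ x); rewrite inE => /(_ nxuv).
    case=> [xD | [y yD yx]]; [left | right; last exists (Some y) => //];
      by rewrite !inE imset_f ?orbT.
  by rewrite cardsU1 card_imset //; case: (_ \notin _) => /=; lia.
exists (Some @: D); last by rewrite card_imset.
apply/dominatesP => -[x _|_].
  move/dominatesP: domD => /(_ x (in_setT _)).
  case=> [xD | [y yD yx]]; [left | right; last exists (Some y) => //];
    exact: imset_f.
right; case/orP: uvD => wD; [exists (Some u) | exists (Some v)];
  by rewrite ?imset_f //= eqxx ?orbT.
Qed.

Lemma gamma_del_new_vertex_le : gamma (del_vertex (new_vertex u v)) <= gamma G.
Proof.
have [D domD leD] := gamma_leP _ _ (leqnn (gamma G)).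
have Some_inj : injective (Some : G -> H) by move=> ? ? [].
have im : Some @: [set: G] = ~: [set new_vertex u v].
  apply/setP => -[x|]; rewrite !inE ?imset_f //=.
  by apply/negP => /imsetP[].
apply/gamma_inducedP; exists (Some @: D : {set H}).
by rewrite -im (dominates_imset Some_inj) // card_imset // imsetS ?subsetT.
Qed.

End AddPathGamma.

(** * Deletion of bad vertices *)

Lemma gamma_del_bad (G : sgraph) (v : G) :
  gamma_bad v -> gamma (del_vertex v) = gamma G.
Proof.
move/gamma_badP => bad; apply/eqP; rewrite eqn_leq; apply/andP; split.
  have [D domD leD] := gamma_leP _ _ (leqnn (gamma G)).
  apply/gamma_inducedP; exists D; split => //.
    (* A minimum dominating set avoids the bad vertex [v]. *)
    by rewrite subsetC sub1set inE; apply/negP => /(bad _ domD); lia.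
  exact: dominates_sub domD.
(* Conversely, adding [v] gives a dominating set containing a bad vertex, so it has more than
   [gamma G] elements. *)
have [D [_ domD leD]] := gamma_inducedP _ _ (leqnn (gamma (del_vertex v))).
have dom' : dominates (v |: D) setT by apply: dominates_setU1; rewrite setTD.
have := bad _ dom' (setU11 _ _); rewrite cardsU1.
by case: (_ \notin _) => /=; lia.
Qed.

Lemma mem_Vminus_del (G : sgraph) (u v : G) : u != v -> gamma_bad v ->
  (u \in [set val x | x in Vminus (del_vertex v)])
  = (gamma (del_set [set u; v]) < gamma G).
Proof.
move=> uv /gamma_del_bad <-; have uA : u \in ~: [set v] by rewrite !inE.
rewrite -[u in LHS]/(val (Sub u uA : del_vertex v)) mem_imset; last exact: val_inj.
by rewrite inE gamma_del_vertex2.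
Qed.

Lemma dominates_setU2 (G : sgraph) (u v : G) (D : {set G}) :
  dominates D (~: [set u; v]) -> dominates (u |: (v |: D)) setT.
Proof.
by move=> domD; do 2!apply: dominates_setU1; rewrite setDDl setTD.
Qed.

Theorem theorem12 (G : sgraph) (u v : G) (huv : u != v) (hadj : ~~ adj u v) :
  (((gamma G)%:Z - 1 <= (gamma (add_path1 u v))%:Z)%R /\
   (gamma (add_path1 u v) <= gamma G + 1)%N) /\
  ((gamma G)%:Z - 1 = (gamma (add_path1 u v))%:Z <->
   (gamma (del_set [set u; v]))%:Z = (gamma G)%:Z - 2)%R /\
  (gamma (add_path1 u v) = (gamma G + 1)%N <->
   [/\ gamma_bad u, gamma_bad v,
       u \notin [set val x | x in Vminus (del_vertex v)] &
       v \notin [set val x | x in Vminus (del_vertex u)]]) /\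
  (gamma (add_path1 u v) = (gamma G + 1)%N ->
   new_vertex u v \in Vminus (add_path1 u v)).
Proof.
set H := add_path1 u v; set F := del_set [set u; v].
have [D0 domD0 leD0] := gamma_leP _ _ (leqnn (gamma G)).
have leU (w : G) (D : {set G}) : #|w |: D| <= #|D|.+1.
  by rewrite cardsU1; case: (_ \notin _) => /=; lia.
have outer_card (D : {set G}) : dominates D (~: [set u; v]) ->
    gamma G <= #|D| + ((u \notin D) + (v \notin D)).
  move=> /dominates_setU2 /gamma_le_card; rewrite !cardsU1 !inE (negPf huv) /=.
  by lia.
have outer_induced (D : {set G}) : dominates D (~: [set u; v]) ->
    [|| u \in D, v \in D | gamma F <= #|D|].
  move=> domD; case: (boolP (u \in D)) (boolP (v \in D)) => //= uD [//|vD] /=.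
  apply/gamma_inducedP; exists D; split => //.
  by rewrite subsetC subUset !sub1set !inE uD vD.
have lower : gamma G <= (gamma H).+1.
  have [[D /outer_card ? ?]|[D [/gamma_le_card ? _ ?]]] :=
    gamma_add_path1_leP _ _ _ (leqnn (gamma H)); by lia.
have upper : gamma H <= gamma G + 1.
  apply/gamma_add_path1_leP; right; exists (u |: D0).
  rewrite setU11; split => //; last by have := leU u D0; lia.
  exact: dominates_sub (subsetUr _ _) _ domD0.
have le_del2 : gamma H <= (gamma F).+1.
  have [D [_ domD leD]] := gamma_inducedP _ _ (leqnn (gamma F)).
  by apply/gamma_add_path1_leP; left; exists D.
have del2_lower : gamma G <= gamma F + 2.
  have [D [_ /outer_card ? ?]] := gamma_inducedP _ _ (leqnn (gamma F)).
  by lia.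
(* Here [D] has at most [gamma G - 2] elements, so by [outer_card] it misses both [u] and [v] and
   lies in [F]. *)
have drop_iff : gamma H < gamma G <-> gamma F + 2 <= gamma G.
  split=> [ltH|]; last by lia.
  have [[D domD leD]|[D [/gamma_le_card ? _ ?]]] :=
    gamma_add_path1_leP _ _ _ (leqnn (gamma H)); last by lia.
  have := outer_card _ domD; have := outer_induced _ domD.
  by case: (u \in D); case: (v \in D) => /=; lia.
have rise_iff :
    gamma G < gamma H <-> [/\ gamma_bad u, gamma_bad v & gamma G <= gamma F].
  split=> [gtH | [/gamma_badP badu /gamma_badP badv leF]].
    (* A dominating set of [G] containing [u] or [v] also dominates [x_1], so its size is at least
       [gamma H]. *)
    have bad w : (w == u) || (w == v) -> gamma_bad w.
      move=> wuv; apply/gamma_badP => D domD wD; apply: leq_trans gtH _.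
      apply/gamma_add_path1_leP; right; exists D; split=> //.
      by case/orP: wuv wD => /eqP -> ->; rewrite ?orbT.
    by split; [apply: bad | apply: bad | ]; rewrite ?eqxx ?orbT //; lia.
  rewrite ltnNge; apply/gamma_add_path1_leP => -[[D domD ltD]|[D [domD]]].
    (* Since [#|D| < gamma G], adding [u] and [v] can exceed [gamma G], as badness demands, only if
       both are new; then [D] lies in [F] and contradicts [leF]. *)
    have domU := dominates_setU2 domD.
    have := badu _ domU (setU11 _ _); have := badv _ domU (setU1r _ (setU11 _ _)).
    have := outer_induced _ domD.
    rewrite !cardsU1 !inE (negPf huv) /=.
    by case: (u \in D); case: (v \in D) => /=; lia.
  by case/orP=> [/(badu _ domD)|/(badv _ domD)]; lia.
split; first by split; lia.
(* [lower] and [del2_lower] turn the inequalities of [drop_iff] into equalities. *)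
split; first by split=> ?; lia.
split; last first.
  by move=> eqH; rewrite inE eqH addn1 ltnS gamma_del_new_vertex_le.
have setC : del_set [set v; u] = F by rewrite /F setUC.
split=> [eqH | [badu badv]].
  have [badu badv leF] : [/\ gamma_bad u, gamma_bad v & gamma G <= gamma F].
    by apply/rise_iff; rewrite eqH addn1.
  by split; rewrite // mem_Vminus_del // 1?eq_sym // ?setC -leqNgt.
rewrite mem_Vminus_del // -leqNgt => leF _.
by apply/eqP; rewrite eqn_leq upper addn1; apply/rise_iff.
Qed.
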